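(* Let $p$ be a prime and let $G$ be a finite $2$-generator $p$-group of nilpotency class two. Then $G$ is $2$-capable if and only if $G$ is capable.
   Context: A group $G$ is $c$-capable ($c\ge1$) if $G\cong H/Z_c(H)$ for some group $H$, where $Z_c(H)$ is the $c$-th term of the upper central series of $H$; capable means $1$-capable, i.e. $G\cong H/Z(H)$ for some group $H$. *)

(* Defs.v *)
From HB Require Import structures.
From mathcomp Require Import all_boot all_fingroup all_solvable.
From mathcomp Require Import boolp.

Set Implicit Arguments.
Unset Strict Implicit.
Unset Printing Implicit Defensive.

Local Open Scope group_scope.
Local Open Scope quotient_scope.

(* The groups [H] below are possibly infinite ([groupType]), so the quotients
   and centers of the finite group library do not apply to them. *)

Record normal_subgroup (H : groupType) := NormalSubgroup {
  nsub_pred :> {pred H};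
  nsub1 : 1 \in nsub_pred;
  nsubM : {in nsub_pred &, forall x y, x * y \in nsub_pred};
  nsubV : {in nsub_pred, forall x, x^-1 \in nsub_pred};
  nsubJ : {in nsub_pred, forall x y, x ^ y \in nsub_pred}
}.

(* [repr] alone denotes the finite group operation. *)
Local Notation rep := generic_quotient.repr.

Section Quotient.

Variables (H : groupType) (N : normal_subgroup H).
Implicit Types x y z : H.

Definition coset_rel x y := x^-1 * y \in N.

Lemma coset_rel_refl : reflexive coset_rel.
Proof. by move=> x; rewrite /coset_rel mulVg nsub1. Qed.

Lemma coset_rel_sym : symmetric coset_rel.
Proof.
have imp x y : coset_rel x y -> coset_rel y x.
  by move=> /nsubV; rewrite /coset_rel invgM invgK.
by move=> x y; apply/idP/idP; apply: imp.
Qed.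

Lemma coset_rel_trans : transitive coset_rel.
Proof.
move=> y x z xy yz; have := nsubM xy yz.
by rewrite -mulgA mulVKg.
Qed.

Canonical coset_equiv :=
  EquivRel coset_rel coset_rel_refl coset_rel_sym coset_rel_trans.

Definition quotient_group := {eq_quot coset_equiv}.

HB.instance Definition _ := Choice.on quotient_group.
HB.instance Definition _ := EqQuotient.on quotient_group.

Lemma coset_eqP x y :
  reflect (\pi_quotient_group x = \pi_quotient_group y) (x^-1 * y \in N).
Proof. by apply: (iffP idP) => [xy|/eqmodP//]; apply/eqmodP. Qed.

Definition qmul (u v : quotient_group) : quotient_group :=
  \pi_quotient_group (rep u * rep v).
Definition qinv (u : quotient_group) : quotient_group :=
  \pi_quotient_group (rep u)^-1.
Definition qone : quotient_group := \pi_quotient_group 1.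

Lemma qmulE x y :
  qmul (\pi_quotient_group x) (\pi_quotient_group y) = \pi_quotient_group (x * y).
Proof.
apply/coset_eqP.
set x' := rep (\pi_quotient_group x); set y' := rep (\pi_quotient_group y).
have x'x : x'^-1 * x \in N by apply/coset_eqP; rewrite reprK.
have y'y : y'^-1 * y \in N by apply/coset_eqP; rewrite reprK.
have -> : (x' * y')^-1 * (x * y) = (x'^-1 * x) ^ y' * (y'^-1 * y).
  by rewrite /conjg invgM !mulgA mulgK.
by rewrite nsubM // nsubJ.
Qed.

Lemma qinvE x : qinv (\pi_quotient_group x) = \pi_quotient_group x^-1.
Proof.
apply/coset_eqP.
set x' := rep (\pi_quotient_group x).
have xx' : x^-1 * x' \in N by apply/coset_eqP; rewrite reprK.
have := nsubJ xx' x^-1.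
by rewrite /conjg !invgK !mulgA mulgV mul1g.
Qed.

Lemma pi_surj (u : quotient_group) : exists x, \pi_quotient_group x = u.
Proof. by exists (rep u); rewrite reprK. Qed.

Lemma qmulA : associative qmul.
Proof.
move=> u v w; have [x <-] := pi_surj u; have [y <-] := pi_surj v.
by have [z <-] := pi_surj w; rewrite !qmulE mulgA.
Qed.

Lemma qmul1g : left_id qone qmul.
Proof. by move=> u; have [x <-] := pi_surj u; rewrite qmulE mul1g. Qed.

Lemma qmulg1 : right_id qone qmul.
Proof. by move=> u; have [x <-] := pi_surj u; rewrite qmulE mulg1. Qed.

Lemma qmulVg : left_inverse qone qinv qmul.
Proof. by move=> u; have [x <-] := pi_surj u; rewrite qinvE qmulE mulVg. Qed.

Lemma qmulgV : right_inverse qone qinv qmul.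
Proof. by move=> u; have [x <-] := pi_surj u; rewrite qinvE qmulE mulgV. Qed.

HB.instance Definition _ :=
  isGroup.Build quotient_group qmulA qmul1g qmulg1 qmulVg qmulgV.

Definition qcoset x : quotient_group := \pi_quotient_group x.

Lemma qcosetM : {morph qcoset : x y / x * y}.
Proof. by move=> x y; rewrite /qcoset -qmulE. Qed.

Lemma qcosetV : {morph qcoset : x / x^-1}.
Proof. by move=> x; rewrite /qcoset -qinvE. Qed.

Lemma qcoset1 : qcoset 1 = 1. Proof. by []. Qed.

Lemma qcoset_surj (u : quotient_group) : exists x, qcoset x = u.
Proof. exact: pi_surj. Qed.

Lemma qcoset_eq x y : (qcoset x = qcoset y) <-> x^-1 * y \in N.
Proof. by split=> [/coset_eqP|xy]; last exact/coset_eqP. Qed.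

End Quotient.

Section UpperCentralSeries.

Definition group_center (H : groupType) : {pred H} :=
  fun x => `[< forall y, x * y = y * x >].
Arguments group_center : clear implicits.

Lemma group_centerP (H : groupType) (x : H) :
  reflect (forall y, x * y = y * x) (x \in group_center H).
Proof. exact: asboolP. Qed.

Variable H : groupType.
Implicit Type N : normal_subgroup H.

Definition trivial_pred : {pred H} := pred1 1.

Lemma trivial_predP x : reflect (x = 1) (x \in trivial_pred).
Proof. exact: eqP. Qed.

Lemma trivial_pred1 : 1 \in trivial_pred.
Proof. exact/trivial_predP. Qed.

Lemma trivial_predM : {in trivial_pred &, forall x y, x * y \in trivial_pred}.
Proof.
by move=> x y /trivial_predP-> /trivial_predP->; apply/trivial_predP/mulg1.
Qed.

Lemma trivial_predV : {in trivial_pred, forall x, x^-1 \in trivial_pred}.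
Proof. by move=> x /trivial_predP->; apply/trivial_predP/invg1. Qed.

Lemma trivial_predJ : {in trivial_pred, forall x y, x ^ y \in trivial_pred}.
Proof. by move=> x /trivial_predP-> y; apply/trivial_predP/conj1g. Qed.

Definition nsub_triv : normal_subgroup H :=
  NormalSubgroup trivial_pred1 trivial_predM trivial_predV trivial_predJ.

Definition center_preim N : {pred H} :=
  fun x => qcoset N x \in group_center (quotient_group N).

Lemma center_preimP N x :
  reflect (forall y, [~ x, y] \in N) (x \in center_preim N).
Proof.
apply: (iffP (group_centerP _)) => [xC y | xC u].
  have /qcoset_eq : qcoset N (y * x) = qcoset N (x * y) by rewrite !qcosetM xC.
  by rewrite invgM -mulgA.
have [y <-] := qcoset_surj u; rewrite -!qcosetM; apply/esym/qcoset_eq.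
by rewrite invgM -mulgA; apply: xC.
Qed.

Section CenterPreim.

Variable N : normal_subgroup H.

Lemma center_preim1 : 1 \in center_preim N.
Proof. by apply/center_preimP=> y; rewrite comm1g nsub1. Qed.

Lemma center_preimM :
  {in center_preim N &, forall x y, x * y \in center_preim N}.
Proof.
move=> x y /group_centerP xC /group_centerP yC; apply/group_centerP=> u.
by rewrite qcosetM -mulgA yC mulgA xC mulgA.
Qed.

Lemma center_preimV : {in center_preim N, forall x, x^-1 \in center_preim N}.
Proof.
move=> x /group_centerP xC; apply/group_centerP=> u; rewrite qcosetV.
by apply: (mulgI (qcoset N x)); rewrite mulVKg mulgA xC mulgK.
Qed.

Lemma center_preimJ : {in center_preim N, forall x y, x ^ y \in center_preim N}.
Proof.
move=> x /group_centerP xC y; apply/group_centerP=> u.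
by rewrite /conjg !qcosetM xC qcosetV mulKg xC.
Qed.

Definition nsub_center_preim : normal_subgroup H :=
  NormalSubgroup center_preim1 center_preimM center_preimV center_preimJ.

End CenterPreim.

(* [Z_0 = 1], and [Z_(n+1)] is the preimage in [H] of the center of
   [H / Z_n]. *)
Fixpoint upper_central (n : nat) : normal_subgroup H :=
  if n is n'.+1 then nsub_center_preim (upper_central n') else nsub_triv.

Lemma upper_centralS n x :
  reflect (forall y, [~ x, y] \in upper_central n) (x \in upper_central n.+1).
Proof. exact: center_preimP. Qed.

Lemma upper_central1 : upper_central 1 =i group_center H.
Proof.
move=> x; apply/upper_centralS/group_centerP => xC y.
  by apply/commgP; have := xC y; rewrite inE.
by rewrite inE; apply/commgP/xC.
Qed.

End UpperCentralSeries.

Definition group_isomorphic (G H : groupType) : Prop :=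
  exists f : G -> H, {morph f : x y / x * y} /\ bijective f.

Definition c_capable (c : nat) (G : groupType) : Prop :=
  exists H : groupType,
    group_isomorphic G (quotient_group (upper_central H c)).

Definition capable (G : groupType) : Prop := c_capable 1 G.

Definition two_generator (gT : finGroupType) (G : {group gT}) : Prop :=
  exists x y : gT, <<[set x; y]>> = G.

(* Main.v *)
Require Import Defs.
From mathcomp Require Import all_boot all_fingroup all_solvable.
From HB Require Import structures.
From mathcomp Require Import boolp zify.

(** Suppose G = K / Z(K), write D for the derived subgroup of G, c = [b, a] in K,
    z1 = [c, a] and z2 = [c, b].  As G is generated by two elements, a word is
    trivial in G exactly when it commutes with both generators in K; so
      a^i = 1 in G           iff  c^i z1^C(i,2) = 1 in K,
      b^i c^C(i,2) = 1 in G  iff  z2^C(i,2) = 1 and c^i z1^C(i,2) z2^C(i,2) = 1.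
    Hence the two left-hand sides are equivalent as soon as z2^C(n,2) = 1, where n
    is the order of a.  One can choose the generators so that this holds and
    <a> meets <b, c> trivially: take for a an element of maximal order modulo D
    that centralizes no nontrivial element of D in K.

    Conversely, let G = <a> |x Q with Q = <b, c>, so that X = a - 1 acts on the
    abelian group Q with X^2 = 0.  Extend Q to B = Q x Q x Q by
    X (u, v, w) = (0, u, v + X w): then X^2 maps B onto Q, and in the semidirect
    product L of B by a cyclic group acting through a = 1 + X, the pair (a^i, v)
    lies in Z_2(L) iff X^2 v = 0 and (1 + a + ... + a^(i-1)) Q = 0.  The latter
    says b^i c^C(i,2) = 1, i.e. a^i = 1, so L / Z_2(L) = <a> |x X^2 B = G. *)

Set Implicit Arguments.
Unset Strict Implicit.
Unset Printing Implicit Defensive.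

Local Open Scope group_scope.

(** * Capability through surjective morphisms *)

Lemma c_capableP (c : nat) (G : groupType) :
  c_capable c G <->
  exists (H : groupType) (f : H -> G),
    [/\ {morph f : x y / x * y}, forall g, exists h, f h = g &
        forall h, f h = 1 <-> h \in upper_central H c].
Proof.
split=> [[H [phi [phiM [psi phiK psiK]]]] | [H [f [fM f_surj f_ker]]]].
  have psiM: {morph psi : u v / u * v}.
    by move=> u v; apply: (can_inj phiK); rewrite phiM !psiK.
  have phi1: phi 1 = 1 by apply: (mulgI (phi 1)); rewrite -phiM !mulg1.
  exists H, (psi \o @qcoset H (upper_central H c)); split=> [x y | g | h] /=.
  - by rewrite qcosetM psiM.
  - by have [h qh] := qcoset_surj (phi g); exists h; rewrite /= qh phiK.
  split=> [/(congr1 phi) | hZ].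
    by rewrite psiK phi1 -qcoset1 => /esym/qcoset_eq; rewrite invg1 mul1g.
  apply: (can_inj phiK); rewrite psiK phi1 -qcoset1.
  by apply/esym/qcoset_eq; rewrite invg1 mul1g.
have f1: f 1 = 1 by apply: (mulgI (f 1)); rewrite -fM !mulg1.
have fV h : f h^-1 = (f h)^-1 by apply: (mulgI (f h)); rewrite -fM !mulgV.
have f_eq x y : f x = f y <-> qcoset (upper_central H c) x = qcoset _ y.
  apply: iff_trans (iff_sym (qcoset_eq _ _ _)); rewrite -f_ker fM fV.
  by split=> [-> | /(canRL (mulKVg _))]; rewrite ?mulVg // mulg1.
pose g u := sval (cid (f_surj u)).
have gK u : f (g u) = u by rewrite /g; case: cid.
exists H, (fun u => qcoset _ (g u)); split=> [u v | ].
  by rewrite -qcosetM; apply/f_eq; rewrite fM !gK.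
exists (fun q => f (sval (cid (qcoset_surj q)))) => [u | q] /=.
  by case: cid => h /= /f_eq->.
by case: cid => h /= <-; apply/f_eq; rewrite gK.
Qed.

(** With [Q = H / Z_c(H)], the center of [Q] is [Z_(c+1)(H) / Z_c(H)], so that [f] factors through
    [Q] with kernel exactly [Z(Q)]. *)
Lemma capable_of_c_capableS (c : nat) (G : groupType) :
  c_capable c.+1 G -> capable G.
Proof.
move=> /c_capableP[H [f [fM f_surj f_ker]]]; apply/c_capableP.
pose Q : groupType := Defs.quotient_group (upper_central H c).
pose rep (q : Q) := sval (cid (qcoset_surj q)).
have repK q : qcoset _ (rep q) = q by rewrite /rep; case: cid.
have f1: f 1 = 1 by apply: (mulgI (f 1)); rewrite -fM !mulg1.
have fV h : f h^-1 = (f h)^-1 by apply: (mulgI (f h)); rewrite -fM !mulgV.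
have f_rep h : f (rep (qcoset _ h)) = f h.
  apply: (mulgI (f h)^-1); rewrite mulVg -fV -fM; apply/f_ker/upper_centralS => y.
  suff Zh: h^-1 * rep (qcoset _ h) \in upper_central H c.
    by rewrite nsubM ?nsubV // nsubJ.
  by apply/qcoset_eq; rewrite repK.
exists Q, (f \o rep); split=> [q r | g | q] /=.
- by rewrite -fM -[in LHS](repK q) -[in LHS](repK r) -qcosetM f_rep.
- by have [h <-] := f_surj g; exists (qcoset _ h); rewrite f_rep.
by rewrite upper_central1 f_ker -{2}(repK q).
Qed.

(** * The semidirect product L *)

Record automorphic_action (T B : groupType) := AutomorphicAction {
  aact :> T -> B -> B;
  aactM : forall s t v, aact (s * t) v = aact t (aact s v);
  aactMr : forall t, {morph aact t : v w / v * w};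
  aact1 : aact 1 =1 id
}.

(** An alias indexed by [to], which keeps the twisted group law apart from that of the direct
    product on the same pairs. *)
Definition semidirect_of (T B : groupType) (to : automorphic_action T B) : Type :=
  T * B.

Section Semidirect.

Variables (T B : groupType) (to : automorphic_action T B).

Local Notation semidirect := (semidirect_of to).

HB.instance Definition _ := Choice.copy semidirect (T * B)%type.

Definition sd_mul (g h : semidirect) : semidirect :=
  (g.1 * h.1, to h.1 g.2 * h.2).
Definition sd_one : semidirect := (1, 1).
Definition sd_inv (g : semidirect) : semidirect :=
  (g.1^-1, to g.1^-1 g.2^-1).

Lemma aactr1 t : to t 1 = 1.
Proof. by apply: (mulgI (to t 1)); rewrite -aactMr !mulg1. Qed.

Lemma sd_mulA : associative sd_mul.
Proof.
by move=> [t v] [s w] [r z]; rewrite /sd_mul /= aactM aactMr !mulgA.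
Qed.

Lemma sd_mul1 : left_id sd_one sd_mul.
Proof. by move=> [t v]; rewrite /sd_mul /= aactr1 !mul1g. Qed.

Lemma sd_mulr1 : right_id sd_one sd_mul.
Proof. by move=> [t v]; rewrite /sd_mul /= aact1 !mulg1. Qed.

Lemma sd_mulV : left_inverse sd_one sd_inv sd_mul.
Proof.
by move=> [t v]; rewrite /sd_mul /sd_inv /= -aactM mulVg aact1 mulVg.
Qed.

Lemma sd_mulrV : right_inverse sd_one sd_inv sd_mul.
Proof.
by move=> [t v]; rewrite /sd_mul /sd_inv /= -aactMr !mulgV aactr1.
Qed.

HB.instance Definition _ :=
  isGroup.Build semidirect sd_mulA sd_mul1 sd_mulr1 sd_mulV sd_mulrV.

Lemma sd_mulE (g h : semidirect) :
  g * h = (g.1 * h.1, to h.1 g.2 * h.2).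
Proof. by []. Qed.

Hypotheses (TC : forall s t : T, s * t = t * s).
Hypotheses (BC : forall v w : B, v * w = w * v).

Lemma sd_commgE (t s : T) (v w : B) :
  [~ (t, v) : semidirect, (s, w)] = (1, (to t w * v)^-1 * (to s v * w)).
Proof.
apply: (mulgI (((s, w) : semidirect) * (t, v))); rewrite -commgC !sd_mulE /=.
by rewrite mulg1 aact1 mulKVg TC.
Qed.

Lemma sd_central (v : B) :
  ((1, v) : semidirect) \in upper_central semidirect 1 <-> forall s, to s v = v.
Proof.
rewrite upper_central1; split=> [/group_centerP vC s | v_fix].
  by have [_] := vC (s, 1); rewrite mulg1 aactr1 mul1g.
apply/group_centerP=> [[s w]]; rewrite !sd_mulE /= aact1 v_fix mulg1 mul1g.
by rewrite BC.
Qed.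

(** Additively, the commutator of [(t, v)] and [(s, w)] is [(s - 1) v - (t - 1) w], and it has to be
    fixed by [T]. Taking [w] or [s] trivial separates the two terms. *)
Lemma sd_central2 (t : T) (v : B) :
  ((t, v) : semidirect) \in upper_central semidirect 2 <->
    (forall r s, to r (v^-1 * to s v) = v^-1 * to s v) /\
    (forall r w, to r (w^-1 * to t w) = w^-1 * to t w).
Proof.
have aactV r w : to r w^-1 = (to r w)^-1.
  by apply: (mulgI (to r w)); rewrite -aactMr !mulgV aactr1.
have commE s w : (to t w * v)^-1 * (to s v * w) =
    (v^-1 * to s v) * (w^-1 * to t w)^-1.
  by rewrite !invgM invgK !mulgA -(mulgA v^-1) (BC (to t w)^-1) mulgA.
split=> [/upper_centralS tvC | [v_fix t_fix]].
  have fix_comm s w : forall r,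
      to r (v^-1 * to s v * (w^-1 * to t w)^-1) =
        v^-1 * to s v * (w^-1 * to t w)^-1.
    by apply/sd_central; rewrite -commE -sd_commgE; apply: tvC.
  split=> r w.
    by have := fix_comm w 1 r; rewrite aactr1 mulVg invg1 mulg1.
  have := fix_comm 1 w r; rewrite aact1 mulVg mul1g aactV.
  exact: invg_inj.
apply/upper_centralS=> [[s w]]; rewrite sd_commgE commE.
by apply/sd_central=> r; rewrite aactMr aactV v_fix t_fix.
Qed.

End Semidirect.

(* Recording a power of [a] next to the power of [x] by which it acts makes the
   map from the acting group to [<[a]>] a projection, although the order of [a]
   need not be known to divide that of [x] beforehand. *)
Section CyclicAction.

Variables (B gT : finGroupType) (x : {perm B}) (a : gT).
Hypothesis xM : {morph x : v w / v * w}.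

Lemma expg_pair i : (x, a) ^+ i = (x ^+ i, a ^+ i).
Proof. by elim: i => // i IHi; rewrite !expgS IHi. Qed.

Lemma cycle_pairP (t : [subg <[(x, a)]> ]) : exists i, sgval t = (x ^+ i, a ^+ i).
Proof. by have /cycleP[i ->] := valP t; exists i; rewrite expg_pair. Qed.

Lemma perm_expM i : {morph x ^+ i : v w / v * w}.
Proof.
by elim: i => [|i IHi] v w; rewrite ?perm1 // expgS !permM xM IHi.
Qed.

Definition pair_act (t : [subg <[(x, a)]> ]) : B -> B := (sgval t).1.

Lemma pair_actM s t v : pair_act (s * t) v = pair_act t (pair_act s v).
Proof. by rewrite /pair_act /= permM. Qed.

Lemma pair_actMr t : {morph pair_act t : v w / v * w}.
Proof.
by rewrite /pair_act; have [i ->] := cycle_pairP t; apply: perm_expM.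
Qed.

Lemma pair_act1 : pair_act 1 =1 id.
Proof. by move=> v; rewrite /pair_act /= perm1. Qed.

Definition pair_action := AutomorphicAction pair_actM pair_actMr pair_act1.

Lemma cycle_pairC (s t : [subg <[(x, a)]> ]) : s * t = t * s.
Proof.
apply: val_inj; rewrite /=.
by apply: (centsP (cycle_abelian (x, a))); apply: valP.
Qed.

End CyclicAction.

(** * The automorphism [1 + X] of the triple product *)

Lemma eq_triple (A : Type) (v w : A * A * A) :
  v.1.1 = w.1.1 -> v.1.2 = w.1.2 -> v.2 = w.2 -> v = w.
Proof. by case: v w => [[? ?] ?] [[? ?] ?] /= -> -> ->. Qed.

Section Prolongation.

Variables (A : finGroupType) (s : A -> A).
Hypotheses (AC : forall u v : A, u * v = v * u) (sM : {morph s : u v / u * v}).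
Hypotheses (s_inj : injective s) (s2 : forall u, s (u^-1 * s u) = u^-1 * s u).

(** This is [1 + X]: additively, the last coordinate [w + (v + X w)] equals [v + s w]. *)
Definition prolong (v : A * A * A) : A * A * A :=
  (v.1.1, v.1.1 * v.1.2, v.1.2 * s v.2).

Lemma prolong_inj : injective prolong.
Proof.
move=> [[u1 v1] w1] [[u2 v2] w2] [-> /mulgI-> /mulgI/s_inj->] //.
Qed.

Definition prolong_perm := perm prolong_inj.

Let AAC u v w : u * v * w = u * w * v :> A.
Proof. by rewrite -!mulgA (AC v). Qed.

Let AMC u v w z : u * v * (w * z) = u * w * (v * z) :> A.
Proof. by rewrite !mulgA (AAC u v). Qed.

Lemma prolongM : {morph prolong_perm : v w / v * w}.
Proof.
move=> [[u1 v1] w1] [[u2 v2] w2]; rewrite !permE /prolong /= sM.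
by apply: eq_triple => //=; apply: AMC.
Qed.

(* [1 + s + ... + s^(i-1)] in additive notation; likewise [prolong_map] below is
   the map [X^2] from [A * A * A] onto [A], with [X = s - 1] on [A]. *)
Definition traceg i (u : A) : A := iter i (fun w => u * s w) 1.

(** A trivial first coordinate is enough, since the powers are only evaluated on the image of
    [X]. *)
Lemma prolong_exp i u w :
  (prolong_perm ^+ i) (1, u, w) = (1, u, traceg i u * iter i s w).
Proof.
elim: i => [|i IHi]; first by rewrite perm1 mul1g.
by rewrite expgSr permM IHi permE /prolong /= mul1g sM mulgA.
Qed.

Lemma prolong_diff u v w :
  (u, v, w)^-1 * prolong_perm (u, v, w) = (1, u, v * (w^-1 * s w)).
Proof.
rewrite permE /prolong /=; apply: eq_triple; rewrite /= ?mulVg //.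
  by rewrite (AC v^-1) mulgK.
by rewrite !mulgA (AC v).
Qed.

Definition prolong_map (v : A * A * A) : A :=
  v.1.1 * (v.1.2^-1 * s v.1.2).

(** As [X^2 = 0] on [A], on triples [X^2 (u, v, w) = (0, 0, u + X v)]. *)
Lemma prolong_diff2 v :
  let d := v^-1 * prolong_perm v in
  prolong_perm d = d <-> prolong_map v = 1.
Proof.
case: v => [[u v] w] /=; rewrite prolong_diff; set y := v * _.
have diff_d: y^-1 * s y = v^-1 * s v.
  by rewrite /y sM s2 invgM (AC _ v^-1) AMC mulVg mulg1.
rewrite permE /prolong /prolong_map /= -diff_d mul1g.
split=> [[uy] | uy]; first by rewrite (AC y^-1) mulgA uy mulgV.
by congr (_, _, _); apply: (mulIg y^-1); rewrite -mulgA (AC _ y^-1) uy mulgV.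
Qed.

Lemma prolong_mapM : {morph prolong_map : v w / v * w}.
Proof.
move=> [[u1 v1] w1] [[u2 v2] w2]; rewrite /prolong_map /= sM invgM.
by rewrite (AC v2^-1) (AMC v1^-1) AMC.
Qed.

Lemma prolong_map_perm v : prolong_map (prolong_perm v) = s (prolong_map v).
Proof.
case: v => [[u v] w]; rewrite permE /prolong /prolong_map /=.
rewrite [in LHS]sM [in RHS]sM s2 invgM (AC v^-1) AMC.
by rewrite -(mulgA u^-1) mulKVg.
Qed.

End Prolongation.

(** * 2-capability of split extensions by a cyclic group *)

(** The morphism [h] sends [(t, v)] to [a^i] times [X^2 v], where [a^i] is the second component of
    [t]. As [<[a]>] meets [Q] trivially, the kernel is given by [a^i = 1] and [X^2 v = 0]; the last
    hypothesis turns [a^i = 1] into the vanishing of [1 + a + ... + a^(i-1)] on [Q], which is what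
    membership in [Z_2] requires of [t]. *)
Lemma c_capable2_cycle_mul (gT : finGroupType) (G Q : {group gT}) (a : gT) :
    a \in 'N(Q) -> abelian Q -> <[a]> * Q = G ->
    {in Q, forall u, [~ u, a] ^ a = [~ u, a]} ->
    (forall i, a ^+ i \in Q -> a ^+ i = 1) ->
    (forall i, a ^+ i = 1 <-> {in Q, forall u, iter i (fun w => u * w ^ a) 1 = 1}) ->
  c_capable 2 [subg G]%type.
Proof.
move=> nQa abQ defG Qa2 tiQ ordQ.
pose s (u : [subg Q]) := subg Q (sgval u ^ a).
have sE u : sgval (s u) = sgval u ^ a by rewrite subgK // memJ_norm // subgP.
have sM : {morph s : u v / u * v}.
  by move=> u v; apply: val_inj; rewrite /= sE conjMg -!sE.
have s_inj : injective s.
  by move=> u v /(congr1 sgval); rewrite !sE => /conjg_inj/val_inj.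
have AC (u v : [subg Q]) : u * v = v * u.
  by apply: val_inj; apply: (centsP abQ); apply: subgP.
have s2 u : s (u^-1 * s u) = u^-1 * s u.
  by apply: val_inj; rewrite /= sE /= sE -commgEl Qa2 // subgP.
pose x := prolong_perm s_inj.
pose H := semidirect_of (pair_action a (prolongM AC sM s_inj)).
pose pm := prolong_map s.
have pm_exp i v : sgval (pm ((x ^+ i) v)) = sgval (pm v) ^ (a ^+ i).
  elim: i v => [|i IHi] v; first by rewrite perm1 conjg1.
  by rewrite !expgS permM IHi /pm prolong_map_perm // sE conjgM.
have pmM : {morph pm : v w / v * w} by apply: prolong_mapM.
have pm_u u : pm (u, 1, 1) = u.
  apply: val_inj; rewrite /pm /prolong_map /= sE /=.
  by rewrite conj1g !(invg1, mulg1).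
have pm_ker v : x (v^-1 * x v) = v^-1 * x v <-> pm v = 1.
  exact: prolong_diff2.
clearbody pm.
pose h (g : H) := (sgval g.1).2 * sgval (pm g.2).
have Gh g : h g \in G.
  rewrite -defG mem_mulg ?subgP // /h.
  by have [i ->] := cycle_pairP g.1; rewrite mem_cycle.
have hM : {morph h : g k / g * k}.
  move=> [t v] [r w].
  rewrite -[LHS]/((sgval t).2 * (sgval r).2 * sgval (pm (pair_act r v * w))).
  rewrite pmM /h /=.
  rewrite /pair_act; have [i ->] := cycle_pairP r => /=.
  by rewrite -/x pm_exp conjgE !mulgA mulgK.
have trE i u : sgval (traceg s i u) = iter i (fun w => sgval u * w ^ a) 1.
  by elim: i => //= i <-; rewrite sE.
have sI i u : sgval (iter i s u) = sgval u ^ (a ^+ i).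
  by elim: i => [|i IHi]; rewrite ?conjg1 //= sE IHi -conjgM expgSr.
apply/c_capableP; exists H, (fun g => subg G (h g)); split=> [g k | g | [t v]].
- by rewrite hM subgM.
- have: sgval g \in <[a]> * Q by rewrite defG subgP.
  case/mulsgP=> _ u /cycleP[i ->] Qu g_def.
  pose t := subg <[(x, a)]> ((x, a) ^+ i).
  exists (t, (subg Q u, 1, 1)); apply: val_inj.
  rewrite [LHS]subgK // [RHS]g_def.
  by rewrite /h pm_u /= !subgK ?mem_cycle // expg_pair.
have subg_eq1 : subg G (h (t, v)) = 1 <-> h (t, v) = 1.
  by split=> [/(congr1 sgval)|hg1]; [rewrite subgK | apply: val_inj; rewrite /= subgK].
rewrite {}subg_eq1.
have BC (u w : [subg Q] * [subg Q] * [subg Q]) : u * w = w * u.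
  by apply: eq_triple => /=; apply: AC.
have xM : {morph x : u w / u * w} by apply: prolongM.
have x1 : x 1 = 1 by apply: (mulgI (x 1)); rewrite -xM !mulg1.
have xV w : x w^-1 = (x w)^-1 by apply: (mulgI (x w)); rewrite -xM !mulgV.
have [i ti] := cycle_pairP t; rewrite -/x in ti.
have xiM := perm_expM xM i.
have xiV w : (x ^+ i) w^-1 = ((x ^+ i) w)^-1.
  apply: (mulgI ((x ^+ i) w)); rewrite -xiM !mulgV.
  by apply: (mulgI ((x ^+ i) 1)); rewrite -xiM !mulg1.
(* Both sides say [(x - 1)(x^i - 1) w = 0], the two factors commuting; the right-hand form is the
   one computed by [prolong_diff] and [prolong_exp]. *)
have swap w : x (w^-1 * (x ^+ i) w) = w^-1 * (x ^+ i) w <->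
              (x ^+ i) (w^-1 * x w) = w^-1 * x w.
  rewrite xM xV xiM xiV -!permM -expgS -expgSr.
  have eqE (p q z : [subg Q] * [subg Q] * [subg Q]) :
      p^-1 * z = w^-1 * q <-> z = p * w^-1 * q.
    by rewrite -mulgA; split=> [<- | ->]; rewrite ?mulKVg ?mulKg.
  by rewrite !eqE -mulgA (BC (x w)) (BC w^-1).
pose gen := subg <[(x, a)]> (x, a).
rewrite sd_central2 //; last exact: cycle_pairC.
rewrite /= /h /pair_act ti /=; split=> [h1 | [v_fix t_fix]].
  have /tiQ ai1 : a ^+ i \in Q by rewrite (canRL (mulgK _) h1) mul1g groupV subgP.
  have pm1 : pm v = 1 by apply: val_inj; rewrite -[LHS]mul1g -ai1.
  have fixg w : x w = w -> forall r : [subg <[(x, a)]> ], (sgval r).1 w = w.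
    move=> xw r; have [j ->] := cycle_pairP r.
    by elim: j => [|j IHj] /=; rewrite ?perm1 // expgS permM xw.
  split=> [r r' | r w]; apply: fixg.
    have [j -> /=] := cycle_pairP r'; rewrite -/x.
    have /pm_ker xd := pm1; elim: j => [|j IHj]; first by rewrite perm1 mulVg.
    rewrite expgSr permM -[(x ^+ j) v](mulKVg v).
    set y := v^-1 * (x ^+ j) v in IHj *.
    by rewrite [x (v * y)]xM mulgA [LHS]xM xd !IHj.
  apply/swap; case: w => [[u1 u2] w]; rewrite prolong_diff // prolong_exp //.
  apply: eq_triple => //=; apply: val_inj => /=.
  by rewrite trE (ordQ i).1 // ?subgP // mul1g sI ai1 conjg1.
have pm1 : pm v = 1.
  by apply/pm_ker; have := v_fix gen gen; rewrite !subgK ?cycle_id.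
have ai1 : a ^+ i = 1.
  (* Here [X (u, 1, 1) = (1, u, 1)], so the last coordinate of its image under [x^i] is the trace of
     [u] alone. *)
  apply/(ordQ i) => u Qu; have := t_fix gen (subg Q u, 1, 1).
  rewrite subgK ?cycle_id // => /swap; rewrite prolong_diff // prolong_exp //.
  move/(congr1 (fun z => sgval z.2)) => /=; rewrite trE subgK // sI !sE /=.
  by rewrite sE !(conj1g, invg1, mulg1).
by rewrite pm1 ai1 mulg1.
Qed.

(** Conjugation by [a] fixes [c] and sends [b] to [b * c], so the traces of [b] and [c] are
    [b^i c^C(i,2)] and [c^i]. The second is trivial as soon as [a^i = 1], because [c^i = [b, a^i]];
    hence [b] alone decides whether the trace vanishes on [Q]. *)
Lemma c_capable2_class2 (gT : finGroupType) (G : {group gT}) (a b : gT) :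
    let c := [~ b, a] in
    <<[set a; b]>> = G -> c \in 'Z(G) ->
    (forall i j k, a ^+ i = b ^+ j * c ^+ k -> a ^+ i = 1) ->
    (forall i, a ^+ i = 1 <-> b ^+ i * c ^+ 'C(i, 2) = 1) ->
  c_capable 2 [subg G]%type.
Proof.
move=> c genG /centerP[Gc cG] tiQ ordQ.
have Ga : a \in G by rewrite -genG mem_gen // !inE eqxx.
have Gb : b \in G by rewrite -genG mem_gen // !inE eqxx orbT.
have ca : commute c a by apply: cG.
have cb : commute c b by apply: cG.
have cbc : <[c]> \subset 'C(<[b]>) by rewrite cent_cycle cycle_subG; apply/cent1P.
pose Q := (<[b]> <*> <[c]>)%G.
have defQ : Q :=: <[b]> * <[c]> by rewrite /= cent_joinEr.
have QP u : u \in Q -> exists j k, u = b ^+ j * c ^+ k.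
  by rewrite defQ => /mulsgP[_ _ /cycleP[j ->] /cycleP[k ->] ->]; exists j, k.
have Qbc j k : b ^+ j * c ^+ k \in Q by rewrite defQ mem_mulg ?mem_cycle.
have cXa k : (c ^+ k) ^ a = c ^+ k.
  by apply/conjg_fixP/commgP/commute_sym/commuteX/commute_sym.
have bXa j : (b ^+ j) ^ a = b ^+ j * c ^+ j.
  by rewrite conjXg conjg_mulR -/c expgMn //; apply: commute_sym.
have bcXa j k : (b ^+ j * c ^+ k) ^ a = b ^+ j * c ^+ k * c ^+ j.
  by rewrite conjMg bXa cXa -!mulgA -!expgD addnC.
have nQa : a \in 'N(Q).
  rewrite inE; apply/subsetP=> _ /imsetP[_ /QP[j [k ->]] ->].
  by rewrite bcXa -mulgA -expgD.
have abQ : abelian Q by rewrite /= abelianY !cycle_abelian cbc.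
have trE i j k : iter i (fun w => b ^+ j * c ^+ k * w ^ a) 1 =
    b ^+ (i * j) * c ^+ ('C(i, 2) * j + i * k).
  elim: i => [|i IHi]; first by rewrite mulg1.
  rewrite iterS IHi bcXa -!mulgA (mulgA (c ^+ k)) (commuteX2 _ _ cb) -!mulgA.
  rewrite -!expgD mulgA -expgD binS bin1; by congr (_ ^+ _ * _ ^+ _); lia.
have defG : <[a]> <*> Q = G :> {set gT}.
  apply/eqP; rewrite eqEsubset !join_subG !cycle_subG Ga Gb Gc /= -genG gen_subG.
  apply/subsetP=> _ /set2P[]->; first by rewrite mem_gen // inE cycle_id.
  by rewrite mem_gen // inE (subsetP (joing_subl _ _)) ?orbT ?cycle_id.
apply: (@c_capable2_cycle_mul _ G Q a) => //.
- by rewrite -norm_joinEl ?cycle_subG.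
- by move=> _ /QP[j [k ->]]; rewrite commgEl bcXa mulKg cXa.
- by move=> i /QP[j [k]]; apply: tiQ.
move=> i; split=> [ai1 _ /QP[j [k ->]] | tr1].
  rewrite trE expgD !expgM mulgA -expgMn ?(ordQ i).1 ?expg1n ?mul1g //; last first.
    by apply/commuteX2/commute_sym.
  by rewrite -commgX ?ai1 ?commg1 ?expg1n //; apply: commute_sym.
have := tr1 _ (Qbc 1%N 0%N); rewrite trE !muln1 muln0 addn0 => /ordQ//.
Qed.

(** * Commutators in a central extension of G *)

Section CommutatorPowers.

Variable K : groupType.
Implicit Types u w z : K.

Lemma central_exp z i :
  (forall v, z * v = v * z) -> forall v, z ^+ i * v = v * z ^+ i.
Proof. by move=> zC v; apply/commute_sym/commuteX/commute_sym/zC. Qed.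

Lemma commute_expl u w z i : (forall v, z * v = v * z) -> u * w = w * u * z ->
  u ^+ i * w = w * u ^+ i * z ^+ i.
Proof.
move=> zC uw; elim: i => [|i IHi]; first by rewrite !mulg1 mul1g.
rewrite [in LHS]expgS -mulgA IHi !mulgA uw -(mulgA _ z) zC.
by rewrite (expgS u) (expgS z) !mulgA.
Qed.

Lemma commute_expr u w z i : (forall v, z * v = v * z) -> u * w = w * u * z ->
  u * w ^+ i = w ^+ i * u * z ^+ i.
Proof.
move=> zC uw; elim: i => [|i IHi]; first by rewrite !mulg1 mul1g.
rewrite [in LHS]expgSr mulgA IHi -!mulgA (central_exp _ zC) (mulgA u) uw.
by rewrite (expgSr w) (expgS z) !mulgA.
Qed.

Variables x y c z1 z2 : K.
Hypotheses (z1C : forall v, z1 * v = v * z1) (z2C : forall v, z2 * v = v * z2).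
Hypotheses (yx : y * x = x * y * c).
Hypotheses (cx : c * x = x * c * z1) (cy : c * y = y * c * z2).

(** Moving [c ^+ i] past one more [x] costs [z1 ^+ i], and these costs add up to the binomial
    coefficient. *)
Lemma commg_expr i : y * x ^+ i = x ^+ i * y * c ^+ i * z1 ^+ 'C(i, 2).
Proof.
elim: i => [|i IHi]; first by rewrite !mulg1 mul1g.
rewrite [in LHS]expgSr mulgA IHi -!mulgA (central_exp _ z1C).
rewrite (mulgA (c ^+ i)) (commute_expl _ z1C cx) !mulgA -(mulgA _ y) yx.
by rewrite binS bin1 addnC expgD (expgSr x) (expgS c) !mulgA.
Qed.

Lemma commg_expl i : y ^+ i * x = x * y ^+ i * c ^+ i * z2 ^+ 'C(i, 2).
Proof.
elim: i => [|i IHi]; first by rewrite !mulg1 mul1g.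
rewrite [in LHS]expgS -mulgA IHi !mulgA yx.
rewrite -(mulgA _ c) (commute_expr _ z2C cy).
rewrite binS bin1 addnC expgD (expgS y) (expgS c) !mulgA.
by rewrite -(mulgA _ (z2 ^+ i)) (central_exp _ z2C) !mulgA.
Qed.

Lemma commg_expM j k :
  y ^+ j * c ^+ k * x =
    x * (y ^+ j * c ^+ k) * (c ^+ j * z2 ^+ 'C(j, 2) * z1 ^+ k).
Proof.
rewrite -mulgA (commute_expl _ z1C cx) !mulgA commg_expl.
rewrite -!mulgA; congr (x * (_ * _)).
rewrite !mulgA -(mulgA _ _ (c ^+ k)) (central_exp _ z2C) mulgA.
by rewrite -!expgD addnC.
Qed.

End CommutatorPowers.

Section CentralExtension.

Variables (K : groupType) (gT : finGroupType) (G : {group gT}) (f : K -> gT).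
Hypotheses (fM : {morph f : u v / u * v}) (fG : forall u, f u \in G).
Hypothesis f_surj : {in G, forall g, exists u, f u = g}.
Hypothesis f_ker : forall u, f u = 1 <-> forall v, u * v = v * u.
Hypothesis GZ : G^`(1) \subset 'Z(G).

Lemma cext1 : f 1 = 1.
Proof. by apply: (mulgI (f 1)); rewrite -fM !mulg1. Qed.

Lemma cextV u : f u^-1 = (f u)^-1.
Proof. by apply: (mulgI (f u)); rewrite -fM !mulgV cext1. Qed.

Lemma cextX u i : f (u ^+ i) = f u ^+ i.
Proof. by elim: i => [|i IHi]; rewrite ?cext1 // !expgS fM IHi. Qed.

Lemma cextR u v : f [~ u, v] = [~ f u, f v].
Proof. by rewrite /commg /conjg !fM !cextV. Qed.

Lemma cext_commute u v w : f u = f v -> commute w u -> commute w v.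
Proof.
move=> uv wu; have /f_ker Zuv : f (u^-1 * v) = 1 by rewrite fM cextV uv mulVg.
by rewrite -(mulKVg u v); apply: commuteM => //; apply/commute_sym/Zuv.
Qed.

Lemma cext_der u v : [~ f u, f v] \in G^`(1).
Proof. by rewrite mem_commg. Qed.

Lemma cext_central u v : f u \in G^`(1) -> forall w, [~ u, v] * w = w * [~ u, v].
Proof.
move=> /(subsetP GZ)/centerP[_ uG]; apply/f_ker; rewrite cextR.
by apply/eqP/commgP/uG.
Qed.

Variables x y : K.
Hypothesis genG : <<[set f x; f y]>> = G.

(** Commuting with [u] depends only on the image in [G], since the kernel of [f] is central. The
    elements of [G] whose preimages commute with [u] thus form a subgroup, and it contains both
    generators. *)
Lemma cext_ker_gen u : f u = 1 <-> commute u x /\ commute u y.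
Proof.
split=> [/f_ker uC | [ux uy]]; first by split; apply: uC.
pose M := [set g in G | `[< forall v, f v = g -> commute u v >]].
have M1 : group_set M.
  apply/group_setP; split=> [|g h].
    rewrite inE group1; apply/asboolP=> v v1.
    by apply: (@cext_commute 1); rewrite ?cext1 //; apply: commute1.
  rewrite !inE => /andP[Gg /asboolP ug] /andP[Gh /asboolP uh].
  rewrite groupM //; apply/asboolP=> v vgh.
  have [w wg] := f_surj Gg; rewrite -(mulKVg w v); apply: commuteM.
    exact: ug.
  by apply: uh; rewrite fM cextV wg vgh mulKg.
have sGM : G \subset Group M1.
  rewrite -genG gen_subG; apply/subsetP=> _ /set2P[]->; rewrite inE fG.
    by apply/asboolP=> v vx; apply: cext_commute ux.
  by apply/asboolP=> v vx; apply: cext_commute uy.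
apply/f_ker=> v; have := subsetP sGM _ (fG v); rewrite inE => /andP[_ /asboolP].
by apply.
Qed.

Let c := [~ y, x].
Let z1 := [~ c, x].
Let z2 := [~ c, y].

Let fc : f c \in G^`(1). Proof. by rewrite cextR cext_der. Qed.
Let z1C : forall w, z1 * w = w * z1. Proof. exact: cext_central. Qed.
Let z2C : forall w, z2 * w = w * z2. Proof. exact: cext_central. Qed.
Let yx : y * x = x * y * c. Proof. exact: commgC. Qed.
Let cx : c * x = x * c * z1. Proof. exact: commgC. Qed.
Let cy : c * y = y * c * z2. Proof. exact: commgC. Qed.

Lemma cext_commute_exp k : commute (c ^+ k) y <-> z2 ^+ k = 1.
Proof.
rewrite /commute (commute_expl _ z2C cy); split=> [/esym/(canLR (mulKg _)) <- |->].
  by rewrite mulVg.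
by rewrite mulg1.
Qed.

Lemma cext_expx i : f x ^+ i = 1 <-> c ^+ i * z1 ^+ 'C(i, 2) = 1.
Proof.
rewrite -cextX cext_ker_gen.
have xx : commute (x ^+ i) x by apply/commute_sym/commuteX.
split=> [[_] | cz]; last first.
  by split=> //; rewrite /commute (commg_expr z1C yx cx) -mulgA cz mulg1.
rewrite /commute (commg_expr z1C yx cx) -mulgA => /(canLR (mulKg _)) <-.
by rewrite mulVg.
Qed.

Lemma cext_expyc j k : f y ^+ j * f c ^+ k = 1 <->
  z2 ^+ k = 1 /\ c ^+ j * z2 ^+ 'C(j, 2) * z1 ^+ k = 1.
Proof.
rewrite -!cextX -fM cext_ker_gen.
rewrite [commute _ x]/commute (commg_expM z1C z2C yx cx cy).
have cXy : commute (y ^+ j * c ^+ k) y <-> commute (c ^+ k) y.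
  have yj : commute y (y ^+ j) by apply: commuteX.
  split=> cy'; last by apply/commute_sym/commuteM => //; apply: commute_sym.
  rewrite -(mulKg (y ^+ j) (c ^+ k)); apply/commute_sym/commuteM.
    exact: commuteV.
  exact: commute_sym.
rewrite cXy cext_commute_exp; split=> [[cz ->]|[-> ->]]; last by rewrite mulg1.
by split=> //; rewrite -[LHS](mulKg (x * (y ^+ j * c ^+ k))) cz mulVg.
Qed.

Lemma cext_expc k : f c ^+ k = 1 <-> z1 ^+ k = 1 /\ z2 ^+ k = 1.
Proof.
have := cext_expyc 0 k; rewrite !mul1g => ->.
by split=> -[].
Qed.

(** By [cext_commute_exp] the hypothesis reads [z2^C(i,2) = 1] whenever [f x ^+ i = 1]. The
    right-hand side provides the same relation by itself, and under it both sides become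
    [c^i z1^C(i,2) = 1]. *)
Lemma cext_exp_compat :
    (forall i, f x ^+ i = 1 -> commute (c ^+ 'C(i, 2)) y) ->
  forall i, f x ^+ i = 1 <-> f y ^+ i * f c ^+ 'C(i, 2) = 1.
Proof.
move=> cCy i; rewrite cext_expyc; split=> [x1 | [z2i]].
  have /cext_commute_exp z2i := cCy i x1.
  by move/cext_expx: x1; rewrite z2i mulg1.
by rewrite z2i mulg1 => /cext_expx.
Qed.

End CentralExtension.

(** * Adapted generators *)

Section PGroups.

Variables (p : nat) (gT : finGroupType) (G : {group gT}).
Hypotheses (p_prime : prime p) (pG : p.-group G).

(** In a cyclic group inclusion of subgroups is divisibility of orders; here [#[h]] divides [p],
    which divides [#[g]]. *)
Lemma mem_cycle_socle (D : {group gT}) g h : cyclic D -> D \subset G ->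
  g \in D -> h \in D -> g != 1 -> h ^+ p = 1 -> h \in <[g]>.
Proof.
move=> cycD sDG Dg Dh g1 /eqP; rewrite -order_dvdn => hp.
rewrite -cycle_subG -(cardSg_cyclic cycD) ?cycle_subG // -!orderE.
apply: dvdn_trans hp _.
have [k oG] := p_natP (mem_p_elt pG (subsetP sDG g Dg)).
rewrite oG; case: k oG => [/eqP|k _]; last by rewrite expnS dvdn_mulr.
by rewrite order_eq1 (negPf g1).
Qed.

Lemma mem_expg_coset (D : {group gT}) g i :
  D <| G -> g \in G -> (g ^+ i \in D) = (#[coset D g] %| i).
Proof.
move=> /andP[_ nDG] Gg; have nDg := subsetP nDG g Gg.
rewrite order_dvdn -morphX //=; apply/idP/eqP=> [/coset_id // |].
by apply: coset_idr; rewrite groupX.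
Qed.

Lemma gen2_der1 a b : <<[set a; b]>> = G -> G^`(1) \subset 'Z(G) ->
  G^`(1) = <[[~ b, a]]>.
Proof.
move=> genG GZ.
have defG : <[b]> <*> <[a]> = G.
  by rewrite -genG setUC joing_idl joing_idr.
rewrite -defG; apply: der1_joing_cycles; rewrite defG.
have Ga : a \in G by rewrite -genG mem_gen // !inE eqxx.
have Gb : b \in G by rewrite -genG mem_gen // !inE eqxx orbT.
by have /subsetIP[_ /subsetP] := GZ; apply; rewrite mem_commg.
Qed.

(* [G^`(1)] lies in the Frattini subgroup, so generation may be tested modulo it. *)
Lemma gen2_exchange a g1 g2 r s :
    a \in G -> <<[set g1; g2]>> = G -> coprime p r ->
    a * (g1 ^+ r * g2 ^+ s)^-1 \in G^`(1) ->
  <<[set a; g2]>> = G.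
Proof.
move=> Ga genG pr.
have G1 : g1 \in G by rewrite -genG mem_gen // !inE eqxx.
have G2 : g2 \in G by rewrite -genG mem_gen // !inE eqxx orbT.
set d := a * _ => Dd.
apply: Phi_nongen; set M := _ <*> _.
have MPhi : 'Phi(G) \subset M by apply: joing_subl.
have sM : [set a; g2] \subset M by apply: joing_subr.
have Ma : a \in M by rewrite (subsetP sM) // !inE eqxx.
have M2 : g2 \in M by rewrite (subsetP sM) // !inE eqxx orbT.
have Md : d \in M.
  by rewrite (subsetP MPhi) // (Phi_joing pG) (subsetP (joing_subl _ _)).
have M1r : g1 ^+ r \in M.
  have -> : g1 ^+ r = d^-1 * a * (g2 ^+ s)^-1.
    by rewrite /d !invgM !invgK mulgKV mulgK.
  by rewrite !groupM ?groupV ?groupX.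
apply/eqP; rewrite eqEsubset; apply/andP; split.
  rewrite join_subG Phi_sub; apply/subsetP=> _ /set2P[]-> //.
rewrite -{1}genG gen_subG; apply/subsetP=> _ /set2P[]-> //.
have /eqP : <[g1]> == <[g1 ^+ r]>.
  rewrite [_ == _]generator_coprime.
  by have [k ->] := p_natP (mem_p_elt pG G1); rewrite coprimeXl.
move=> g1E; have: g1 \in <[g1 ^+ r]> by rewrite -g1E cycle_id.
by apply/subsetP; rewrite cycle_subG.
Qed.

(** Modulo the derived subgroup, [a = g1^r g2^s]. If [p] divided both [r] and [s], the order of [a]
    would divide the exponent over [p], against maximality; the exponent is not 1 because the
    derived subgroup is proper. So [a] can replace [g1] or [g2]. *)
Lemma gen2_exponent_coset a :
    (exists x y, <<[set x; y]>> = G) -> a \in G -> G^`(1) \proper G ->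
    #[coset G^`(1) a] = exponent (G / G^`(1)) ->
  exists2 b, b \in G & <<[set a; b]>> = G.
Proof.
move=> [g1 [g2 genG]] Ga properD oa.
have G1 : g1 \in G by rewrite -genG mem_gen // !inE eqxx.
have G2 : g2 \in G by rewrite -genG mem_gen // !inE eqxx orbT.
have nD : G \subset 'N(G^`(1)) by apply: der_norm.
have nDg g : g \in G -> g \in 'N(G^`(1)) by apply: subsetP.
have abGD : abelian (G / G^`(1)) by apply: sub_der1_abelian.
have : coset G^`(1) a \in <[coset G^`(1) g1]> * <[coset G^`(1) g2]>.
  have <- : (<[g1]> <*> <[g2]>) / G^`(1) = <[coset G^`(1) g1]> * <[coset G^`(1) g2]>.
    rewrite quotientY ?cycle_subG ?nDg // !quotient_cycle ?nDg // cent_joinEr //.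
    rewrite cent_cycle cycle_subG; apply/cent1P/(centsP abGD); exact: mem_quotient.
  by apply: mem_quotient; rewrite /= joing_idl joing_idr [_ <*> _]genG.
case/mulsgP=> _ _ /cycleP[r ->] /cycleP[s ->] arsE.
have modD u : u \in G -> coset G^`(1) a = coset G^`(1) u -> a * u^-1 \in G^`(1).
  move=> Gu au; apply: coset_idr; first by rewrite groupM ?groupV ?nDg.
  by rewrite morphM ?morphV ?groupV ?nDg //= au mulgV.
have morph2 u v i j : u \in G -> v \in G ->
    coset G^`(1) (u ^+ i * v ^+ j) = coset G^`(1) u ^+ i * coset G^`(1) v ^+ j.
  by move=> Gu Gv; rewrite morphM ?morphX ?groupX ?nDg.
have cC : commute (coset G^`(1) g1) (coset G^`(1) g2).
  by apply: (centsP abGD); apply: mem_quotient.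
have [pr | npr] := boolP (p %| r); last first.
  exists g2 => //; apply: (@gen2_exchange a g1 g2 r s) => //.
    by rewrite prime_coprime.
  by apply: modD; rewrite ?morph2 // groupM ?groupX.
have [ps | nps] := boolP (p %| s); last first.
  exists g1 => //; apply: (@gen2_exchange a g2 g1 s r) => //.
  - by rewrite setUC.
  - by rewrite prime_coprime.
  apply: modD; rewrite ?morph2 ?groupM ?groupX // arsE.
  by apply: commuteX2.
have /p_natP[e oGD] : p.-nat (exponent (G / G^`(1))).
  by rewrite pnat_exponent quotient_pgroup.
case: e oGD => [|e] oGD.
  case/negP: (proper_subn properD); apply/subsetP=> g Gg.
  apply: coset_idr; first exact: nDg.
  by have := expg_exponent (mem_quotient G^`(1) Gg); rewrite oGD expg1.
suff: #[coset G^`(1) a] %| p ^ e.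
  by rewrite oa oGD dvdn_Pexp2l ?prime_gt1 // ltnn.
have killed g k : g \in G -> p %| k -> coset G^`(1) g ^+ (k * p ^ e) = 1.
  move=> Gg /dvdnP[k' ->]; rewrite -mulnA -expnS -oGD mulnC expgM.
  by rewrite expg_exponent ?expg1n // mem_quotient.
rewrite order_dvdn arsE expgMn; last exact: commuteX2.
by rewrite -!expgM !killed ?mulg1.
Qed.

End PGroups.

(** * Arithmetic of [C(n, 2)] *)

Lemma mul2_bin2 n : (2 * 'C(n, 2) = n * n.-1)%N.
Proof.
rewrite mul2n bin2 even_halfK //.
by case: n => // n; rewrite oddM /= andNb.
Qed.

(** For odd [p], [N] already divides [C(N, 2)]; for [p = 2] the product is [N (N - 1)]. *)
Lemma dvd_pfactor_bin2 p N : prime p -> p.-nat N -> N %| (p * 'C(N, 2))%N.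
Proof.
move=> p_prime /p_natP[e ->].
have [odd_p | even_p] := boolP (odd p).
  by rewrite bin2odd ?oddX ?odd_p ?orbT // dvdn_mull // dvdn_mulr.
have -> : p = 2 by case: (even_prime p_prime) => // odd_p; rewrite odd_p in even_p.
by rewrite mul2_bin2 dvdn_mulr.
Qed.

(** A proper divisor of [N] divides [N / p], which divides [C(N, 2)]. Applied to the order of the
    derived subgroup, this settles the shape of the exceptional case. *)
Lemma pfactor_ndvd_bin2 p q N :
  prime p -> p.-nat N -> q %| N -> ~~ (q %| 'C(N, 2)) -> q = N.
Proof.
move=> p_prime pN qN nqC; have NpC := dvd_pfactor_bin2 p_prime pN.
have [e oN] := p_natP pN; rewrite {}oN in qN nqC NpC *.
have [g le_ge oq] := dvdn_pfactor q e p_prime qN.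
move: le_ge; rewrite leq_eqVlt => /predU1P[<- // | lt_ge].
case: e => // e in lt_ge qN nqC NpC *.
rewrite {1}expnS dvdn_pmul2l ?prime_gt0 // in NpC.
by case/negP: nqC; apply: dvdn_trans NpC; rewrite oq dvdn_exp2l.
Qed.

(** Among [k] blocks of [n] points, a pair lies within one block or joins two blocks. *)
Lemma bin2_mul n k : 'C(n * k, 2) = (k * 'C(n, 2) + n * (n * 'C(k, 2)))%N.
Proof.
apply/eqP; rewrite -(eqn_pmul2l (isT : 0 < 2)) mulnDr.
rewrite (mulnCA 2 k) (mulnCA 2 n) (mulnCA 2 n) !mul2_bin2; apply/eqP.
by case: n k => [|n] [|k]; rewrite ?muln0 ?mul0n //=; nia.
Qed.

(** A cyclic subgroup of maximal order is a direct factor of the abelian group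
    [G / G^](1)[;]b[generates a complement modulo]G^[(1)]. *)
Lemma gen2_complement (gT : finGroupType) (G : {group gT}) (a b1 : gT) :
    <<[set a; b1]>> = G -> #[coset G^`(1) a] = exponent (G / G^`(1)) ->
  exists b, <<[set a; b]>> = G /\
    forall i j d, d \in G^`(1) -> a ^+ i = b ^+ j * d -> a ^+ i \in G^`(1).
Proof.
move=> genG oa.
have Ga : a \in G by rewrite -genG mem_gen // !inE eqxx.
have Gb1 : b1 \in G by rewrite -genG mem_gen // !inE eqxx orbT.
have sDG : G^`(1) \subset G := der_sub 1 G.
have nDG : G \subset 'N(G^`(1)) := der_norm 1 G.
have nsDG : G^`(1) <| G := der_normal 1 G.
have nDg g : g \in G -> g \in 'N(G^`(1)) by apply: subsetP.
have abGD : abelian (G / G^`(1)) by apply: sub_der1_abelian.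
pose S := (<[a]> <*> G^`(1))%G.
have sDS : G^`(1) \subset S by apply: joing_subr.
have Sa : a \in S by rewrite (subsetP (joing_subl _ _)) ?cycle_id.
have sSG : S \subset G by rewrite join_subG cycle_subG Ga sDG.
have nsSG : S <| G by apply: sub_der1_normal.
set N := exponent _ in oa.
have ND g : g \in G -> g ^+ N \in G^`(1).
  by move=> Gg; rewrite (mem_expg_coset _ nsDG) // dvdn_exponent // mem_quotient.
pose m := #[coset S b1].
have mP j : (b1 ^+ j \in S) = (m %| j) by apply: mem_expg_coset nsSG _.
have /dvdnP[t oN] : m %| N by rewrite -mP (subsetP sDS) ?ND.
have [l [d Dd b1m]] : exists l, exists2 d, d \in G^`(1) & b1 ^+ m = a ^+ l * d.
  have: b1 ^+ m \in S by rewrite mP.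
  rewrite /= norm_joinEl ?cycle_subG ?nDg // => /mulsgP[_ d /cycleP[l ->] Dd ->].
  by exists l, d.
have cb1 : coset G^`(1) b1 ^+ m = coset G^`(1) a ^+ l.
  have Gd := subsetP sDG d Dd.
  rewrite -!morphX ?nDg // b1m morphM ?groupX ?nDg //=.
  by rewrite (coset_id Dd) mulg1.
have t_gt0 : 0 < t by have := exponent_gt0 (G / G^`(1)); rewrite -/N oN; case: t {oN}.
have Nlt : N %| (l * t)%N.
  rewrite -oa order_dvdn expgM -cb1 -expgM mulnC -oN -morphX ?nDg //=.
  by rewrite coset_id // ND.
have /dvdnP[l' ol] : m %| l by rewrite -(dvdn_pmul2l t_gt0) -oN mulnC.
pose b := b1 * a ^- l'.
have Gb : b \in G by rewrite groupM ?groupV ?groupX.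
have Dbm : b ^+ m \in G^`(1).
  apply: coset_idr; first by rewrite groupX ?nDg.
  rewrite morphX ?nDg // morphM ?groupV ?groupX ?nDg // morphV ?groupX ?nDg //.
  rewrite morphX ?nDg //= expgMn; last first.
    by apply: (centsP abGD); rewrite ?groupV ?groupX ?mem_quotient.
  by rewrite cb1 ol expgVn -expgM mulgV.
exists b; split=> [|i j d' Dd' aiE].
  apply/eqP; rewrite eqEsubset gen_subG; apply/andP; split.
    by apply/subsetP=> _ /set2P[]->.
  have Ma : a \in <<[set a; b]>> by rewrite mem_gen // !inE eqxx.
  have Mb : b \in <<[set a; b]>> by rewrite mem_gen // !inE eqxx orbT.
  rewrite -{1}genG gen_subG; apply/subsetP=> _ /set2P[]-> //.
  by rewrite -(mulgKV (a ^+ l') b1) groupM ?groupX.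
have Sb : coset S b = coset S b1.
  have nS g : g \in G -> g \in 'N(S) by apply/subsetP; case/andP: nsSG.
  rewrite morphM ?groupV ?groupX ?nS //=.
  by rewrite [X in _ * X]coset_id ?mulg1 // groupV groupX.
have : m %| j.
  rewrite /m -Sb -(mem_expg_coset _ nsSG) // (canRL (mulgK d') (esym aiE)).
  by rewrite groupM ?groupX ?groupV // (subsetP sDS).
by case/dvdnP=> j' jE; rewrite aiE groupM // jE mulnC expgM groupX.
Qed.

Section AdaptedGenerators.

Variables (p : nat) (gT : finGroupType) (G : {group gT}) (K : groupType) (f : K -> gT).
Hypotheses (p_prime : prime p) (pG : p.-group G) (gen2G : two_generator G).
Hypotheses (GZ : G^`(1) \subset 'Z(G)) (nabG : ~~ abelian G).
Hypotheses (fM : {morph f : u v / u * v}) (fG : forall u, f u \in G).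
Hypothesis f_surj : {in G, forall g, exists u, f u = g}.
Hypothesis f_ker : forall u, f u = 1 <-> forall v, u * v = v * u.

Let f1 := cext1 fM.
Let fX := cextX fM.
Let fR := cextR fM.

(** For [f u] in the derived subgroup, [[u, x]] is central in [K] and depends only on [f u]; the
    condition is that the induced map into the center has trivial kernel. *)
Definition faithful_on_der (x : K) :=
  forall u, f u \in G^`(1) -> commute u x -> f u = 1.

(* The derived subgroup is a cyclic [p]-group: each of its nontrivial subgroups
   contains all its elements of order [p]. *)
Lemma commute_of_not_faithful x : ~ faithful_on_der x ->
  forall u, f u \in G^`(1) -> f u ^+ p = 1 -> commute u x.
Proof.
move=> /existsNP[u0 /not_implyP[Du0 /not_implyP[u0x /eqP u0_neq1]]] u Du up.
have cycD : cyclic G^`(1).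
  have [a [b genG]] := gen2G.
  by rewrite (gen2_der1 genG GZ) cycle_cyclic.
have /cycleP[j uE] : f u \in <[f u0]>.
  by apply: (mem_cycle_socle pG cycD) => //; apply: der_sub.
apply/commute_sym/(cext_commute fM f_ker (u := u0 ^+ j)); first by rewrite fX.
exact/commuteX/commute_sym.
Qed.

Lemma der1_proper : G^`(1) \proper G.
Proof.
rewrite properE der_sub /=; apply/negP=> sGD; case/negP: nabG.
exact: subset_trans (subset_trans sGD GZ) (subsetIr _ _).
Qed.

Lemma exists_faithful_max_coset : exists x, faithful_on_der x /\
  #[coset G^`(1) (f x)] = exponent (G / G^`(1)).
Proof.
have nDG : G \subset 'N(G^`(1)) := der_norm 1 G.
have pGD : p.-group (G / G^`(1)) by apply: quotient_pgroup.
have abGD : abelian (G / G^`(1)) by apply: sub_der1_abelian.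
have [_ /morphimP[a nDa Ga ->] oa] := exponent_witness (abelian_nil abGD).
have [x0 x0a] := f_surj Ga; rewrite -{a}x0a in nDa Ga oa.
have [good_x0 | bad_x0] := pselect (faithful_on_der x0); first by exists x0.
have x0C := commute_of_not_faithful bad_x0.
have D_neq1 : G^`(1) != 1 by apply/eqP=> /derG1P; apply/negP.
have /(Cauchy p_prime)[g Dg og] : p %| #|G^`(1)|.
  have /p_natP[[|k] oD] : p.-nat #|G^`(1)| by apply: pgroupS pG; apply: der_sub.
    by rewrite trivg_card1 oD eqxx in D_neq1.
  by rewrite oD expnS dvdn_mulr.
have [u ug] := f_surj (subsetP (der_sub 1 G) g Dg).
have Du : f u \in G^`(1) by rewrite ug.
have up : f u ^+ p = 1 by rewrite ug -og expg_order.
have [y uy] : exists y, ~ commute u y.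
  apply/existsNP => uC; have /f_ker := uC; rewrite ug => g1.
  by move: (prime_gt1 p_prime); rewrite -og g1 order1.
have not_bad v : ~ commute u v -> faithful_on_der v.
  by move=> uv; apply: contrapT => /commute_of_not_faithful/(_ u Du up).
have good_y := not_bad _ uy.
have good_xy : faithful_on_der (x0 * y).
  apply: not_bad => uxy; apply: uy; rewrite -(mulKg x0 y).
  by apply: commuteM => //; apply/commuteV/x0C.
have [oy | oy] := eqVneq #[coset G^`(1) (f y)] (exponent (G / G^`(1))).
  by exists y.
exists (x0 * y); split=> //; apply/eqP/negPn/negP=> oxy.
have /p_natP[e oN] : p.-nat (exponent (G / G^`(1))) by rewrite pnat_exponent.
have nD v : f v \in 'N(G^`(1)) by apply: subsetP nDG _ _.
have lt_order v : #[coset G^`(1) (f v)] != exponent (G / G^`(1)) ->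
    coset G^`(1) (f v) ^+ (p ^ e.-1) = 1.
  have: #[coset G^`(1) (f v)] %| exponent (G / G^`(1)).
    by rewrite dvdn_exponent // mem_quotient.
  rewrite oN => /(dvdn_pfactor _ _ p_prime)[k le_ke ok]; rewrite ok => neq_ke.
  apply/eqP; rewrite -order_dvdn ok dvdn_exp2l //.
  have lt_ke : k < e by rewrite ltn_neqAle le_ke andbT; apply: contraNneq neq_ke => ->.
  by rewrite -ltnS (ltn_predK lt_ke).
have := lt_order _ oxy; rewrite fM morphM ?nD //= expgMn; last first.
  by apply: (centsP abGD); apply: mem_quotient.
rewrite (lt_order _ oy) mulg1 => /eqP; rewrite -order_dvdn -oa oN.
(* For [e = 0] the predecessor [e.-1] is again 0 and gives no contradiction; but then the exponent
   is 1 and [y] has maximal order after all. *)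
case: e oN {lt_order} => [|e] oN; last by rewrite dvdn_Pexp2l ?prime_gt1 // ltnn.
have : #[coset G^`(1) (f y)] %| exponent (G / G^`(1)).
  by rewrite dvdn_exponent // mem_quotient.
by rewrite {1}oN dvdn1 => /eqP y1; rewrite y1 oN eqxx in oy.
Qed.

Lemma exists_adapted_generators : exists a b, [/\ <<[set a; b]>> = G,
    forall i j k, a ^+ i = b ^+ j * [~ b, a] ^+ k -> a ^+ i = 1 &
    forall i, a ^+ i = 1 <-> b ^+ i * [~ b, a] ^+ 'C(i, 2) = 1].
Proof.
have [x [good_x ox]] := exists_faithful_max_coset.
have nsDG : G^`(1) <| G := der_normal 1 G.
set N := exponent _ in ox.
have pN : p.-nat N by rewrite pnat_exponent quotient_pgroup.
have DN g : g \in G -> g ^+ N \in G^`(1).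
  by move=> Gg; rewrite (mem_expg_coset _ nsDG) // dvdn_exponent // mem_quotient.
have x1 i : f x ^+ i \in G^`(1) -> f x ^+ i = 1.
  by rewrite -fX => Dx; apply: good_x => //; apply/commute_sym/commuteX.
have xN i : f x ^+ i = 1 -> N %| i.
  by move=> xi; rewrite -ox -(mem_expg_coset _ nsDG) // xi.
have cz y : <<[set f x; f y]>> = G ->
    [~ y, x] ^+ N * [~ y, x, x] ^+ 'C(N, 2) = 1.
  by move=> genG; apply/(cext_expx fM fG f_surj f_ker GZ genG)/x1/DN.
have zC y w : forall v, [~ y, x, w] * v = v * [~ y, x, w].
  by apply: (cext_central fM fG f_ker GZ); rewrite fR mem_commg.
have cN y : <<[set f x; f y]>> = G -> f [~ y, x] ^+ N = 1.
  move=> /cz/(congr1 f); rewrite fM !fX.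
  have /f_ker-> := zC y x.
  by rewrite expg1n mulg1 f1.
suff [y [genG tiD cCy]] : exists y, [/\ <<[set f x; f y]>> = G,
    forall i j d, d \in G^`(1) -> f x ^+ i = f y ^+ j * d -> f x ^+ i \in G^`(1) &
    commute ([~ y, x] ^+ 'C(N, 2)) y].
  exists (f x), (f y); rewrite -fR; split=> // [i j k xE | ].
    by apply/x1/(tiD i j _ _ xE)/groupX; rewrite fR mem_commg.
  apply: (cext_exp_compat fM fG f_surj f_ker GZ genG) => i /xN/dvdnP[k ->].
  have commE := cext_commute_exp fM fG f_ker GZ x y.
  (* From [N] to its multiple: [C(N k, 2)] is [k C(N, 2)] plus a multiple of [N], and [z2^N = 1]. *)
  move/commE: cCy => z2C; apply/commE; rewrite mulnC bin2_mul expgD mulnC expgM z2C.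
  have /(cext_expc fM fG f_surj f_ker GZ genG)[_ z2N] : f [~ y, x] ^+ N = 1.
    exact: cN genG.
  by rewrite !expg1n mul1g expgM z2N expg1n.
have [b0 Gb0 genb0] : exists2 b, b \in G & <<[set f x; b]>> = G.
  by apply: (gen2_exponent_coset p_prime pG) => //; apply: der1_proper.
(* If the divisibility fails, then [p = 2] and [#|G^`(1)| = N].  If moreover
   [c^C(N,2)] does not commute with [y], then [y] is faithful on [G^`(1)] as well,
   so [y^N = 1] in [G]; thus [z1^C(N,2) = z2^C(N,2)], and [y * x] can replace [y]. *)
have [qC | nqC] := boolP (#|G^`(1)| %| 'C(N, 2)).
  have [b [genG tiD]] := gen2_complement genb0 ox.
  have Gb : b \in G by rewrite -genG mem_gen // !inE eqxx orbT.
  have [y yb] := f_surj Gb; exists y; rewrite yb; split=> //.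
  suff /f_ker : f ([~ y, x] ^+ 'C(N, 2)) = 1 by apply.
  rewrite fX fR; apply/eqP; rewrite -order_dvdn; apply: dvdn_trans qC.
  by rewrite order_dvdG // mem_commg.
have [y yb0] := f_surj Gb0; rewrite -{b0}yb0 in Gb0 genb0.
have oD z : <<[set f x; f z]>> = G -> #[[~ f z, f x]] = N.
  move=> genG; have defD := gen2_der1 genG GZ.
  rewrite orderE -defD; apply: (pfactor_ndvd_bin2 p_prime pN) => //.
  by rewrite defD -orderE order_dvdn -fR cN.
have tiD z : <<[set f x; f z]>> = G ->
    forall i j d, d \in G^`(1) -> f x ^+ i = f z ^+ j * d -> f x ^+ i \in G^`(1).
  move=> genG i j d Dd xE.
  have /centerP[_ dC] := subsetP GZ d Dd.
  have /centerP[_ cC] : [~ f z, f x] \in 'Z(G) by apply: (subsetP GZ); apply: mem_commg.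
  have zx1 : [~ f z, f x] ^+ j = 1.
    rewrite -commXg; last by apply: commute_sym; apply: cC.
    rewrite (canRL (mulgK d) (esym xE)); apply/eqP/commgP/commute_sym/commuteM.
      exact: commuteX.
    by apply: commuteV; apply/commute_sym/dC.
  have /dvdnP[k jE] : N %| j by rewrite -(oD z genG) order_dvdn zx1.
  by rewrite xE groupM // jE mulnC expgM groupX ?DN.
have [cCy | ncCy] := pselect (commute ([~ y, x] ^+ 'C(N, 2)) y).
  by exists y; split=> //; apply: tiD.
exists (y * x).
have genyx : <<[set f x; f (y * x)]>> = G.
  apply/eqP; rewrite eqEsubset gen_subG; apply/andP; split.
    by apply/subsetP=> _ /set2P[]->.
  have Mx : f x \in <<[set f x; f (y * x)]>> by rewrite mem_gen // !inE eqxx.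
  have Myx : f (y * x) \in <<[set f x; f (y * x)]>>.
    by rewrite mem_gen // !inE eqxx orbT.
  rewrite -{1}genb0 gen_subG; apply/subsetP=> _ /set2P[]-> //.
  by rewrite -(mulgK (f x) (f y)) -fM groupM ?groupV.
split; [by [] | exact: tiD | ].
have good_y : faithful_on_der y.
  (* The image of [c^C(N,2)] has order dividing [p], since [N] divides [p C(N, 2)]. *)
  apply: contrapT => /commute_of_not_faithful bad_y; apply/ncCy/bad_y.
    by rewrite fX fR groupX ?mem_commg.
  rewrite fX -expgM; apply/eqP; rewrite -order_dvdn fR oD // mulnC.
  exact: dvd_pfactor_bin2.
have y1 : f y ^+ N = 1.
  by rewrite -fX; apply: good_y; rewrite ?fX ?DN //; apply/commute_sym/commuteX.
set c := [~ y, x]; set z1 := [~ c, x]; set z2 := [~ c, y].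
have cz1 : c ^+ N * z1 ^+ 'C(N, 2) = 1 := cz y genb0.
have cz2 : c ^+ N * z2 ^+ 'C(N, 2) = 1.
  have := (cext_expyc fM fG f_surj f_ker GZ genb0 N 0).1.
  by rewrite !mulg1 => /(_ y1)[].
have [z1N _] := (cext_expc fM fG f_surj f_ker GZ genb0 N).1 (cN y genb0).
have z12 : z1 ^+ 'C(N, 2) * z2 ^+ 'C(N, 2) = 1.
  have -> : z2 ^+ 'C(N, 2) = z1 ^+ 'C(N, 2) by apply: (mulgI (c ^+ N)); rewrite cz1 cz2.
  by rewrite -expgD addnn -mul2n mul2_bin2 expgM z1N expg1n.
have fc : f [~ y * x, x] = f c.
  rewrite !fR fM commMgJ commgg mulg1.
  have /centerP[_ cC] : [~ f y, f x] \in 'Z(G) by apply: (subsetP GZ); apply: mem_commg.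
  by apply/conjg_fixP/commgP/cC.
(* The new commutator [[y * x, x]] equals [c] modulo the center of [K], and [c^C(N,2)] commutes with
   [y * x] up to [z1^C(N,2) z2^C(N,2)], which is trivial. *)
apply/commute_sym/(cext_commute fM f_ker (u := c ^+ 'C(N, 2))).
  by rewrite !fX fc.
have cx : c * x = x * c * z1 := commgC c x.
have cy : c * y = y * c * z2 := commgC c y.
rewrite /commute [RHS]mulgA (commute_expl _ (zC y y) cy).
rewrite -[RHS]mulgA (central_exp _ (zC y y)) [RHS]mulgA -(mulgA y _ x).
by rewrite (commute_expl _ (zC y x) cx) -!mulgA z12 mulg1 !mulgA.
Qed.

End AdaptedGenerators.

Theorem corollaryD (p : nat) (gT : finGroupType) (G : {group gT})
    (p_prime : prime p) (pG : p.-group G) (gen2 : two_generator G)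
    (class2 : nil_class G = 2) :
  c_capable 2 [subg G]%type <-> capable [subg G]%type.
Proof.
split=> [|/c_capableP[K [f [fM f_surj f_ker]]]]; first exact: capable_of_c_capableS.
have GZ : G^`(1) \subset 'Z(G) by rewrite -nil_class2 class2.
have nabG : ~~ abelian G by rewrite -nil_class1 class2.
have [||a [b [genG tiG ordG]]] := exists_adapted_generators (f := sgval \o f)
  p_prime pG gen2 GZ nabG (fun u v => congr1 sgval (fM u v)) (fun u => subgP (f u)).
- move=> g Gg; have [u fu] := f_surj (subg G g).
  by exists u; rewrite /= fu subgK.
- move=> u /=; have -> : sgval (f u) = 1 <-> f u = 1.
    by split=> [fu1 | ->] //; apply: val_inj.
  rewrite f_ker upper_central1.
  by split=> [/group_centerP | uC] //; apply/group_centerP.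
apply: (c_capable2_class2 genG _ tiG ordG); apply: (subsetP GZ).
by apply: mem_commg; rewrite -genG mem_gen // !inE eqxx ?orbT.
Qed.
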